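(* Let $P_e(P_N)$ be the symbol error rate, as a function of the noise (jammer) power $P_N$, of an arbitrary constellation in the AWGN channel with maximum-likelihood detection, and suppose there is a single inflection point $P_0$, $P_e''(P_0)=0$, so that $P_e''(P_N)>0$ if $P_N<P_0$ and $P_e''(P_N)<0$ if $P_N>P_0$. Consider, for given average noise power $P_N$, the jammer power/time sharing problem $$\max_{k,\ \{\alpha_1,\dots,\alpha_k\},\ \{P_{N1},\dots,P_{Nk}\}}\ \sum_{i=1}^k\alpha_iP_e(P_{Ni})\quad\text{subject to}\quad\sum_{i=1}^k\alpha_i=1,\ \ \sum_{i=1}^k\alpha_iP_{Ni}=P_N .$$ The sub-optimum solution to this problem is to use the single power level $P_{N1}=P_N$ (always ''on'') if $P_N\ge P_0$, and the ''on-off'' strategy with on-interval $\alpha_1=P_N/P_0$ and $P_{N1}=P_0$ if $P_N<P_0$; that is, $$\{\alpha_i,P_{Ni},\ i=1,\dots,k\}=\begin{cases}k=1,\ \alpha_1=1,\ P_{N1}=P_N,&P_N\ge P_0,\\[2pt] k=2,\ \alpha_1=\dfrac{P_N}{P_0},\ P_{N1}=P_0,\ P_{N2}=0,&P_N<P_0,\end{cases}$$ which achieves the symbol error rate $$\tilde P_e(P_N)=\begin{cases}P_e(P_N),&P_N\ge P_0,\\[2pt] \dfrac{P_N}{P_0}P_e(P_0),&P_N<P_0.\end{cases}$$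
   Context: Symbol error rate: a constellation is a set of $M\ge2$ distinct points $\mathbf{s}_1,\dots,\mathbf{s}_M\in\mathbb{R}^n$, normalized by $\frac1M\sum_i|\mathbf{s}_i|^2=1$, with prior probabilities $\Pr[\mathbf{s}=\mathbf{s}_i]$ summing to 1. With decision regions $\Omega_i=\{\mathbf{x}\in\mathbb{R}^n:\ (\mathbf{s}_j-\mathbf{s}_i)^T\mathbf{x}\le\frac12|\mathbf{s}_j-\mathbf{s}_i|^2\ \forall j\ne i\}$ and noise $\boldsymbol\xi\sim\mathcal N(\mathbf 0,P_N\mathbf I)$, set $P_{ei}(P_N)=1-\int_{\Omega_i}(2\pi P_N)^{-n/2}e^{-|\mathbf{x}|^2/(2P_N)}\,d\mathbf{x}$ for $P_N>0$ and $P_e=\sum_iP_{ei}\Pr[\mathbf{s}=\mathbf{s}_i]$; at zero noise power $P_e(0)=\lim_{P_N\to0^+}P_e(P_N)=0$. Primes denote derivatives in $P_N$. In the sharing problem the jammer splits its transmission into $k$ sub-intervals, $\alpha_i\ge0$ being the fractional length and $P_{Ni}\ge0$ the noise power of the $i$-th one, with average noise power $P_N$; the objective is the symbol error rate over the whole transmission interval. When $k=2$, $\alpha_2=1-\alpha_1$. ''Sub-optimum solution'' is an informal term: a sharing strategy satisfying the constraints that is meant to improve on no sharing ($k=1$) but need not attain the maximum. *)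

(* Defs.v *)
From HB Require Import structures.
From mathcomp Require Import all_boot all_order all_algebra.
From mathcomp Require Import all_classical all_reals all_analysis.

Set Implicit Arguments.
Unset Strict Implicit.
Unset Printing Implicit Defensive.

Import Order.TTheory GRing.Theory Num.Theory.
Import numFieldNormedType.Exports.

Local Open Scope classical_set_scope.
Local Open Scope ring_scope.

(* Points of R^n are [n.-tuple R]: tuples carry the product of the Borel
   sigma-algebras in the library, row vectors carry none. *)

Section euclidean.
Context {R : realType} {n : nat}.
Implicit Types x y : n.-tuple R.

Definition dot x y : R := \sum_(l < n) tnth x l * tnth y l.

Definition vsub x y : n.-tuple R := [tuple tnth x l - tnth y l | l < n].

Definition enorm x : R := Num.sqrt (dot x x).

End euclidean.

Section lebesgue_cons.
Context {R : realType} {n : nat}.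
Local Notation mR := (measurableTypeR R).
Variable m : {sigma_finite_measure set (n.-tuple mR) -> \bar R}.

Definition cons_pair (p : mR * n.-tuple mR) : n.+1.-tuple mR :=
  [tuple of p.1 :: p.2].

Definition uncons (t : n.+1.-tuple mR) : mR * n.-tuple mR :=
  (thead t, [tuple of behead t]).

Lemma cons_pairK : cancel cons_pair uncons.
Proof. by case=> a t; rewrite /uncons theadE; congr pair; apply: val_inj. Qed.

Lemma measurable_cons_pair : measurable_fun setT cons_pair.
Proof. exact: measurable_cons. Qed.

Lemma measurable_uncons : measurable_fun setT uncons.
Proof.
apply: measurable_fun_pair; first exact: (measurable_tnth ord0).
exact: measurable_behead.
Qed.

(* The image of [lebesgue_measure \x m] under R * R^n = R^n.+1. *)
Definition lebesgue_cons : set (n.+1.-tuple mR) -> \bar R :=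
  pushforward (lebesgue_measure \x m)%E cons_pair.

Let lebesgue_cons0 : lebesgue_cons set0 = 0%E.
Proof. by rewrite /lebesgue_cons /pushforward preimage_set0 measure0. Qed.

Let lebesgue_cons_ge0 A : (0 <= lebesgue_cons A)%E.
Proof. by rewrite /lebesgue_cons /pushforward measure_ge0. Qed.

Let lebesgue_cons_sigma_additive : semi_sigma_additive lebesgue_cons.
Proof.
rewrite /lebesgue_cons.
exact: (@measure_semi_sigma_additive _ _ _
  [the {measure set _ -> \bar R} of
    measure_function_pushforward__canonical__measure_function_Measure
      (lebesgue_measure \x m)%E measurable_cons_pair]).
Qed.

HB.instance Definition _ := isMeasure.Build _ _ _ lebesgue_cons
  lebesgue_cons0 lebesgue_cons_ge0 lebesgue_cons_sigma_additive.

Let lebesgue_cons_sigma_finite : sigma_finite setT lebesgue_cons.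
Proof.
have /sigma_finiteP[F [FT ndF Foo]] := sigma_finiteT (@lebesgue_measure R).
have /sigma_finiteP[G [GT ndG Goo]] := sigma_finiteT m.
exists (fun i => uncons @^-1` (F i `*` G i)) => [|i].
  apply/seteqP; split=> // t _.
  have [j _ Fj] : (\bigcup_j F j) (uncons t).1 by rewrite -FT.
  have [k _ Gk] : (\bigcup_k G k) (uncons t).2 by rewrite -GT.
  exists (maxn j k) => //; split.
  - by move: Fj; exact/subsetPset/ndF/leq_maxl.
  - by move: Gk; exact/subsetPset/ndG/leq_maxr.
have [mF Fi] := Foo i; have [mG Gi] := Goo i; split.
  rewrite -[X in measurable X]setTI; apply: measurable_uncons => //.
  exact: measurableX.
rewrite /lebesgue_cons /pushforward (_ : _ @^-1` _ = F i `*` G i).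
  by rewrite product_measure1E// lte_mul_pinfty// ge0_fin_numE.
rewrite -comp_preimage (_ : _ \o _ = id)//.
by apply/funext => p; exact: cons_pairK.
Qed.

HB.instance Definition _ := Measure_isSigmaFinite.Build _ _ _ lebesgue_cons
  lebesgue_cons_sigma_finite.

End lebesgue_cons.

(* Lebesgue measure on R^n, starting from the unit mass on the one-point R^0. *)
Fixpoint lebesgue_tuple {R : realType} (n : nat) :
    {sigma_finite_measure set (n.-tuple (measurableTypeR R)) -> \bar R} :=
  match n return
    {sigma_finite_measure set (n.-tuple (measurableTypeR R)) -> \bar R} with
  | 0 => \d_([tuple] : 0.-tuple (measurableTypeR R))
  | n'.+1 => lebesgue_cons (lebesgue_tuple n')
  end.

Section symbol_error_rate.
Context {R : realType} {n M : nat}.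
Implicit Types (s : 'I_M -> n.-tuple R) (prior : 'I_M -> R).

Definition constellation s : Prop :=
  [/\ (2 <= M)%N, injective s & M%:R^-1 * \sum_(i < M) enorm (s i) ^+ 2 = 1].

Definition prior_distribution prior : Prop :=
  (forall i, 0 <= prior i) /\ \sum_(i < M) prior i = 1.

(* Maximum-likelihood decision region of [s i], with origin moved to [s i]. *)
Definition decision_region s (i : 'I_M) : set (n.-tuple (measurableTypeR R)) :=
  [set x | forall j, j != i ->
     dot (vsub (s j) (s i)) x <= 2^-1 * enorm (vsub (s j) (s i)) ^+ 2].

Definition noise_pdf (P : R) (x : n.-tuple R) : R :=
  (2 * pi * P) `^ (- (n%:R / 2)) * expR (- (enorm x ^+ 2 / (2 * P))).

Definition symbol_error s (i : 'I_M) (P : R) : R :=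
  1 - \int[lebesgue_tuple n]_(x in decision_region s i) noise_pdf P x.

Definition ser_pos s prior (P : R) : R :=
  \sum_(i < M) symbol_error s i P * prior i.

(* The Gaussian density is meaningless at zero power, where the error rate is
   its right limit.  Values at negative powers are irrelevant. *)
Definition ser s prior (P : R) : R :=
  if P == 0 then lim (ser_pos s prior Q @[Q --> 0^'+]) else ser_pos s prior P.

End symbol_error_rate.

Definition single_inflection {R : realType} (f : R -> R) (P0 : R) : Prop :=
  [/\ 0 < P0,
      derive1n 2 f P0 = 0,
      forall P : R, 0 < P -> P < P0 -> 0 < derive1n 2 f P &
      forall P : R, P0 < P -> derive1n 2 f P < 0].

(* A sharing strategy with k sub-intervals is the sequence of its k pairs
   (fractional length alpha_i, noise power P_Ni). *)
Section sharing.
Context {R : realType}.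
Implicit Types (f : R -> R) (PN : R) (S : seq (R * R)).

Definition feasible PN S : Prop :=
  [/\ forall p : R * R, p \in S -> 0 <= p.1 /\ 0 <= p.2,
      \sum_(p <- S) p.1 = 1 &
      \sum_(p <- S) p.1 * p.2 = PN].

Definition sharing_ser f S : R := \sum_(p <- S) p.1 * f p.2.

Definition optimal_ser f PN : \bar R :=
  ereal_sup [set (sharing_ser f S)%:E | S in feasible PN].

Definition no_sharing PN : seq (R * R) := [:: (1, PN)].

Definition on_off_sharing (P0 PN : R) : seq (R * R) :=
  if P0 <= PN then [:: (1, PN)] else [:: (PN / P0, P0); (1 - PN / P0, 0)].

Definition on_off_ser f (P0 PN : R) : R :=
  if P0 <= PN then f PN else PN / P0 * f P0.

End sharing.

(* Main.v *)
Require Import Defs.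
From mathcomp Require Import all_boot all_order all_algebra.
From mathcomp Require Import all_classical all_reals all_analysis.
From mathcomp Require Import measurable_realfun ring lra.

Import Order.TTheory GRing.Theory Num.Theory.
Import numFieldNormedType.Exports.

Local Open Scope classical_set_scope.
Local Open Scope ring_scope.

(* Each decision region contains a ball around the origin, outside of which the
   density at power P is at most O(P) times the density at power 2P; hence
   [Pe(P) = O(P)] as [P -> 0+].  After the substitution u = 1/(2P),
   differentiation under the integral sign shows that [Pe] is differentiable on
   (0, oo).  On [0, P0] the function [Pe] is thus continuous, vanishes at 0 and
   has an increasing derivative in the interior, hence lies strictly below its
   chord from (0, 0) to (P0, Pe(P0)); the on-off strategy realizes the chord. *)

(** * Strict convexity and chords *)

(* [lim] of a non-convergent filter is the default point 0. *)
Lemma derivable_derive1_neq0 {R : realType} (f : R -> R) (x : R) :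
  derive1 f x != 0 -> derivable f x 1.
Proof.
apply: contraNP => /dvgP fx; rewrite derive1E /derive fx.
exact/eqP.
Qed.

(** The mean slope of [f] on [[0, x]] is a value of [f'] taken left of [x], that on [[x, b]] one
    taken right of [x]. Since [f'] increases strictly, the first slope is the smaller one. *)
Lemma chord_lt {R : realType} (f : R -> R) (b x : R) :
  {within `[0, b], continuous f} -> f 0 = 0 ->
  {in `]0, b[, forall y, derivable f y 1} ->
  {in `]0, b[, forall y, 0 < derive1n 2 f y} ->
  0 < x -> x < b -> f x < x / b * f b.
Proof.
move=> cf f0 df ddf x0 xb.
have b0 : 0 < b := lt_trans x0 xb.
(* A nonzero value of [derive1n 2 f] already forces differentiability of [derive1 f]. *)
have ddf' : {in `]0, b[, forall y, derivable (derive1 f) y 1}.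
  by move=> y yb; apply: derivable_derive1_neq0; rewrite gt_eqF// ddf.
have f'_lt : {in `]0, b[ &, {homo (derive1 f) : y z / y < z}}.
  apply: (gtr0_derive1_lt_oo ddf' ddf).
  move=> y /[!inE] yb.
  exact/differentiable_continuous/derivable1_diffP/ddf'.
have f'P (y : R) : 0 < y < b -> is_derive y 1 f (derive1 f y).
  move=> yb; rewrite derive1E; apply: DeriveDef => //.
  by apply: df; rewrite in_itv.
have [c1 + E1] : exists2 c, c \in `]0, x[ & f x - f 0 = derive1 f c * (x - 0).
  apply: MVT => //.
    move=> y; rewrite in_itv/= => /andP[y0 yx].
    by apply: f'P; apply/andP; split; lra.
  apply: continuous_subspaceW cf; apply: subset_itvScc; rewrite bnd_simp//.
  exact: ltW.
have [c2 + E2] : exists2 c, c \in `]x, b[ & f b - f x = derive1 f c * (b - x).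
  apply: MVT => //.
    move=> y; rewrite in_itv/= => /andP[y0 yx].
    by apply: f'P; apply/andP; split; lra.
  apply: continuous_subspaceW cf; apply: subset_itvScc; rewrite bnd_simp//.
  exact: ltW.
rewrite !in_itv/= => /andP[xc2 c2b] /andP[c10 c1x].
have dlt : derive1 f c1 < derive1 f c2.
  by apply: f'_lt; rewrite ?in_itv/= ?c10 ?c2b ?(lt_trans c1x) ?(lt_trans x0).
have fx : f x = derive1 f c1 * x by rewrite -[x in RHS]subr0 -E1 f0 subr0.
have fb : f b = derive1 f c1 * x + derive1 f c2 * (b - x).
  by rewrite -fx -E2 addrC subrK.
rewrite mulrAC ltr_pdivlMr// fx fb -subr_gt0.
set p := derive1 f c1; set q := derive1 f c2.
(* This is [b] times the gap between the chord and [f] at [x], in terms of the two slopes. *)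
suff -> : x * (p * x + q * (b - x)) - p * x * b = x * (b - x) * (q - p).
  by rewrite !mulr_gt0// subr_gt0.
by ring.
Qed.

(** * The Gaussian density on R^n and its total mass *)

Section gaussian.
Context {R : realType}.
Local Notation mR := (measurableTypeR R).

Lemma dot_ge0 n (x : n.-tuple R) : 0 <= dot x x.
Proof. by apply: sumr_ge0 => l _; rewrite -expr2 sqr_ge0. Qed.

Lemma sqr_enorm n (x : n.-tuple R) : enorm x ^+ 2 = dot x x.
Proof. by rewrite sqr_sqrtr// dot_ge0. Qed.

Lemma dot_cons_pair n (a : R) (t : n.-tuple R) :
  dot (cons_pair (a, t)) (cons_pair (a, t)) = a ^+ 2 + dot t t.
Proof.
rewrite /dot big_ord_recl; congr (_ + _).
by apply: eq_bigr => i _; rewrite !tnthS.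
Qed.

Lemma measurable_dot n (v : n.-tuple R) :
  measurable_fun setT (dot v : n.-tuple mR -> mR).
Proof.
apply: measurable_sum => l; apply: measurable_funM => //.
exact: measurable_tnth.
Qed.

Lemma measurable_sqnorm n :
  measurable_fun setT ((fun x => dot x x) : n.-tuple mR -> mR).
Proof.
by apply: measurable_sum => l; apply: measurable_funM; exact: measurable_tnth.
Qed.

(** The density without its normalizing factor, in the parameter [u = 1 / (2 P)], which enters the
    exponent linearly. *)
Definition gauss n (u : R) (x : n.-tuple R) : R := expR (- (u * dot x x)).

Lemma measurable_gauss n u :
  measurable_fun setT (gauss n u : n.-tuple mR -> mR).
Proof.
apply: measurableT_comp => //; apply: measurableT_comp => //.
by apply: measurable_funM => //; exact: measurable_sqnorm.
Qed.

Lemma noise_pdfE n (P : R) (x : n.-tuple R) :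
  noise_pdf P x = (2 * pi * P) `^ (- (n%:R / 2)) * gauss n (2 * P)^-1 x.
Proof. by rewrite /noise_pdf sqr_enorm /gauss [dot x x / _]mulrC. Qed.

Lemma noise_pdf_ge0 n (P : R) (x : n.-tuple R) : 0 <= noise_pdf P x.
Proof. by rewrite mulr_ge0 ?powR_ge0 ?expR_ge0. Qed.

Lemma measurable_noise_pdf n (P : R) :
  measurable_fun setT (noise_pdf P : n.-tuple mR -> mR).
Proof.
have -> : @noise_pdf R n P =
    fun x => (2 * pi * P) `^ (- (n%:R / 2)) * gauss n (2 * P)^-1 x.
  by apply/funext => x; exact: noise_pdfE.
by apply: measurable_funM => //; exact: measurable_gauss.
Qed.

(** Isotropic noise has independent coordinates of standard deviation [sqrt P]; this drives the
    induction on the dimension. *)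
Lemma noise_pdf_cons_pair n (P a : R) (t : n.-tuple R) : 0 < P ->
  noise_pdf P (cons_pair (a, t)) =
  normal_pdf 0 (Num.sqrt P) a * noise_pdf P t.
Proof.
move=> P0; rewrite normal_pdfE; last by rewrite gt_eqF// sqrtr_gt0.
rewrite /normal_peak /normal_fun sqr_sqrtr ?ltW// subr0.
rewrite /noise_pdf !sqr_enorm dot_cons_pair.
have p0 : 0 < 2 * pi * P by rewrite !mulr_gt0 ?pi_gt0.
have -> : - (n.+1%:R / 2) = - 2^-1 + - (n%:R / 2) :> R.
  by rewrite -[n.+1%:R]natr1; field.
rewrite powRD; last by rewrite (gt_eqF p0) implybT.
rewrite powRN powR12_sqrt ?ltW//.
have -> : - ((a ^+ 2 + dot t t) / (2 * P)) =
    - a ^+ 2 / (P *+ 2) + - (dot t t / (2 * P)).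
  by rewrite -mulr_natl; field; rewrite gt_eqF.
have -> : P * pi *+ 2 = 2 * pi * P by ring.
by rewrite expRD; ring.
Qed.

Lemma integral_noise_pdf n (P : R) : 0 < P ->
  (\int[lebesgue_tuple n]_x (noise_pdf P x)%:E = 1)%E.
Proof.
move=> P0; elim: n => [|n IH].
  rewrite /= integral_dirac//; last first.
    by apply/measurable_EFinP; exact: measurable_noise_pdf.
  rewrite diracT mul1e /noise_pdf sqr_enorm /dot big_ord0.
  by rewrite !mul0r !oppr0 powRr0 expR0 mul1r.
(* [lebesgue_tuple n.+1] is by construction the image of a product measure under [cons_pair], so the
   integral is pulled back to the product and iterated. *)
rewrite [LHS](@ge0_integral_pushforward _ _ _ _ _ _ measurable_cons_pair
  (lebesgue_measure \x lebesgue_tuple n)%E setT)//; last 2 first.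
- by apply/measurable_EFinP; exact: measurable_noise_pdf.
- by move=> x _; rewrite lee_fin noise_pdf_ge0.
rewrite preimage_setT fubini_tonelli1//; last 2 first.
- apply: measurableT_comp => //; last exact: measurable_cons_pair.
  by apply/measurable_EFinP; exact: measurable_noise_pdf.
- by move=> x /=; rewrite lee_fin noise_pdf_ge0.
rewrite /fubini_F -[RHS](@integral_normal_pdf R 0 (Num.sqrt P)).
apply: eq_integral => a _ /=.
under eq_integral do rewrite noise_pdf_cons_pair// EFinM.
rewrite ge0_integralZl ?lee_fin ?normal_pdf_ge0 ?IH ?mule1//.
- by apply/measurable_EFinP; exact: measurable_noise_pdf.
- by move=> x _; rewrite lee_fin noise_pdf_ge0.
Qed.

Lemma integrable_noise_pdf n (P : R) : 0 < P ->
  (lebesgue_tuple n).-integrable setT (EFin \o noise_pdf P).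
Proof.
move=> P0; apply/integrableP; split.
  by apply/measurable_EFinP; exact: measurable_noise_pdf.
under eq_integral do rewrite /= ger0_norm ?noise_pdf_ge0//.
by rewrite integral_noise_pdf// ltry.
Qed.

(** Up to a constant factor this is the noise density at power [1 / (2 u)]. *)
Lemma integrable_gauss n (u : R) : 0 < u ->
  (lebesgue_tuple n).-integrable setT (EFin \o gauss n u).
Proof.
move=> u0; pose P := (2 * u)^-1.
have P0 : 0 < P by rewrite invr_gt0 mulr_gt0.
have p0 : 0 < 2 * pi * P by rewrite !mulr_gt0 ?pi_gt0.
have -> : EFin \o gauss n u =
    (fun x => ((2 * pi * P) `^ (n%:R / 2))%:E * (noise_pdf P x)%:E)%E.
  apply/funext => x; rewrite -EFinM noise_pdfE mulrA.
  rewrite -powRD ?(gt_eqF p0) ?implybT// subrr powRr0 mul1r.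
  have -> : (2 * P)^-1 = u by rewrite /P; field; rewrite gt_eqF.
  by [].
by apply: integrableZl => //; exact: integrable_noise_pdf.
Qed.
End gaussian.

(** * Gaussian mass away from the origin *)

Section tail.
Context {R : realType} {n : nat}.
Local Notation mR := (measurableTypeR R).
Implicit Types (A : set (n.-tuple mR)) (x v : n.-tuple R).

Lemma dot_eq0 v : dot v v = 0 -> forall l, tnth v l = 0.
Proof.
move=> /psumr_eq0P v0 l; apply/eqP; rewrite -sqrf_eq0 expr2 v0//.
by move=> k _; rewrite -expr2 sqr_ge0.
Qed.

(* Expand [0 <= |v / 2 - x|^2]. *)
Lemma dot_le v x : dot v x <= 4^-1 * dot v v + dot x x.
Proof.
rewrite /dot mulr_sumr -big_split/=; apply: ler_sum => l _.
by have := sqr_ge0 (2^-1 * tnth v l - tnth x l); rewrite !expr2; lra.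
Qed.

Lemma integral_noise_pdf_setC A (P : R) : measurable A -> 0 < P ->
  1 - \int[lebesgue_tuple n]_(x in A) noise_pdf P x =
  \int[lebesgue_tuple n]_(x in ~` A) noise_pdf P x.
Proof.
move=> mA P0; apply/eqP; rewrite subr_eq addrC -Rintegral_setU//.
- by rewrite setUv /Rintegral integral_noise_pdf.
- exact: measurableC.
- by rewrite setUv; exact: integrable_noise_pdf.
- by apply/disj_setPCl.
Qed.

(** Half of the exponent is that of the density at [2 P], the other half is kept as a decaying
    factor; the power of 2 is the ratio of the normalizing constants. *)
Lemma noise_pdf_double (P : R) x : 0 < P ->
  noise_pdf P x =
  2 `^ (n%:R / 2) * expR (- (dot x x / (4 * P))) * noise_pdf (2 * P) x.
Proof.
move=> P0; rewrite /noise_pdf sqr_enorm.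
have p0 : 0 < 2 * pi * P by rewrite !mulr_gt0 ?pi_gt0.
have -> : 2 * pi * (2 * P) = 2 * (2 * pi * P) by ring.
rewrite [(2 * (_ * P)) `^ _]powRM// ?ltW//.
have -> : - (dot x x / (2 * P)) =
    - (dot x x / (4 * P)) + - (dot x x / (2 * (2 * P))).
  by field; rewrite gt_eqF.
rewrite expRD [2 `^ (- _)]powRN; field.
by rewrite gt_eqF// powR_gt0.
Qed.

Lemma noise_tail_ub A (d P : R) : measurable A -> 0 < d ->
  (forall x, A x -> d <= dot x x) -> 0 < P ->
  \int[lebesgue_tuple n]_(x in A) noise_pdf P x <=
  2 `^ (n%:R / 2) * (4 / d) * P.
Proof.
move=> mA d0 Ad P0; set K := 2 `^ (n%:R / 2).
have K0 : 0 < K by rewrite powR_gt0.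
have P20 : 0 < 2 * P by rewrite mulr_gt0.
have C0 : 0 <= K * (4 / d) * P by rewrite !mulr_ge0 ?invr_ge0// ltW.
have intP Q : 0 < Q ->
    (lebesgue_tuple n).-integrable A (EFin \o noise_pdf Q).
  move=> Q0; apply: (integrableS measurableT) => //.
  exact: integrable_noise_pdf.
apply: (@le_trans _ _ (\int[lebesgue_tuple n]_(x in A)
    (K * (4 / d) * P * noise_pdf (2 * P) x))).
  apply: le_Rintegral => //; first exact: intP.
    rewrite (_ : _ \o _ = fun x =>
      ((K * (4 / d) * P)%:E * (EFin \o noise_pdf (2 * P)) x)%E)//.
    by apply: integrableZl => //; exact: intP.
  move=> x Ax; rewrite noise_pdf_double// ler_wpM2r ?noise_pdf_ge0//.
  rewrite -mulrA ler_wpM2l ?(ltW K0)//.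
  (* With [y = |x|^2 / (4 P) >= d / (4 P)], the inequality [exp y >= 1 + y >= y] bounds the decaying
     factor by [4 P / d]. *)
  have y0 : 0 < dot x x / (4 * P).
    by rewrite divr_gt0 ?mulr_gt0// (lt_le_trans d0)// Ad.
  rewrite expRN invf_ple ?posrE ?expR_gt0 ?mulr_gt0 ?invr_gt0//.
  apply: (le_trans _ (expR_ge1Dx _)).
  apply: (@le_trans _ _ (dot x x / (4 * P))); last by rewrite lerDr.
  have -> : (4 / d * P)^-1 = d / (4 * P) by field; rewrite !gt_eqF.
  by rewrite ler_wpM2r ?Ad// invr_ge0 mulr_ge0// ltW.
rewrite RintegralZl//; last exact: intP.
rewrite -[leRHS]mulr1 ler_wpM2l//.
(* The mass of [A] is at most 1, since that of its complement is nonnegative. *)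
have := integral_noise_pdf_setC A (2 * P) mA P20.
have : 0 <= \int[lebesgue_tuple n]_(x in ~` A) noise_pdf (2 * P) x.
  by apply: Rintegral_ge0 => x _; exact: noise_pdf_ge0.
lra.
Qed.
End tail.

(** * Decision regions and a linear bound on the symbol error *)

Section decision_region.
Context {R : realType} {n M : nat} (s : 'I_M -> n.-tuple R) (i : 'I_M).

Lemma measurable_decision_region : measurable (decision_region s i).
Proof.
rewrite (_ : decision_region s i = \bigcap_(j in [set j | j != i])
  (setT `&` [set x : n.-tuple (measurableTypeR R) | dot (vsub (s j) (s i)) x <=
     2^-1 * enorm (vsub (s j) (s i)) ^+ 2])); last first.
  apply/seteqP; split => [x Dx j ji|x Dx j ji]; first by split => //; exact: Dx.
  by have [] := Dx j ji.
apply: fin_bigcap_measurable => [|j _]; first exact: finite_finset.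
by apply: measurable_fun_le => //; exact: measurable_dot.
Qed.

Hypothesis s_inj : injective s.

Lemma decision_region_ball :
  exists2 d : R, 0 < d & forall x, ~ decision_region s i x -> d <= dot x x.
Proof.
pose v j := vsub (s j) (s i).
(* The squared half distance from [s i] to the nearest other point; the starting value 1 caps it and
   covers the case of no other point. *)
exists (\big[Order.min/1]_(j | j != i) (4^-1 * dot (v j) (v j))).
  apply: lt_bigmin => // j ji; rewrite mulr_gt0// lt_neqAle dot_ge0 andbT.
  apply: contra_neqN ji => /eqP v0; apply/s_inj/eq_from_tnth => l.
  have := dot_eq0 _ (esym v0) l; rewrite tnth_mktuple => /eqP.
  by rewrite subr_eq0 => /eqP.
move=> x; apply: contra_notP => /negP; rewrite -ltNge => xd j ji.
have vj : dot x x <= 4^-1 * dot (v j) (v j).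
  exact/ltW/(lt_le_trans xd)/bigmin_le_cond.
rewrite sqr_enorm -/(v j).
by have := dot_le (v j) x; lra.
Qed.

Lemma symbol_error_ge0 (P : R) : 0 < P -> 0 <= symbol_error s i P.
Proof.
move=> P0; rewrite /symbol_error integral_noise_pdf_setC//.
  by apply: Rintegral_ge0 => x _; exact: noise_pdf_ge0.
exact: measurable_decision_region.
Qed.

Lemma symbol_error_ub :
  exists C : R, forall P, 0 < P -> symbol_error s i P <= C * P.
Proof.
have [d d0 sd] := decision_region_ball.
exists (2 `^ (n%:R / 2) * (4 / d)) => P P0.
have mD := measurable_decision_region.
rewrite /symbol_error integral_noise_pdf_setC//.
by apply: noise_tail_ub => //; exact: measurableC.
Qed.
End decision_region.

(** The rate is squeezed between 0 and [K * P], so the [lim] that defines [ser] at zero power is a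
    genuine limit. *)
Lemma ser_pos_cvg0 {R : realType} {n M : nat} (s : 'I_M -> n.-tuple R)
    (prior : 'I_M -> R) : injective s -> (forall i, 0 <= prior i) ->
  ser_pos s prior Q @[Q --> 0^'+] --> 0.
Proof.
move=> s_inj prior_ge0.
have /choice[C Cub] i := symbol_error_ub s i s_inj.
pose K := \sum_(i < M) C i * prior i.
apply: (@squeeze_cvgr _ _ _ _ (cst 0) (fun P => K * P)).
- near=> P; have P0 : 0 < P by near: P; exact: nbhs_right_gt.
  apply/andP; split.
    by apply: sumr_ge0 => i _; rewrite mulr_ge0// symbol_error_ge0.
  rewrite mulr_suml; apply: ler_sum => i _.
  by rewrite mulrAC ler_wpM2r// Cub.
- exact: cvg_cst.
- apply: cvg_at_right_filter; rewrite -[X in _ --> X](mulr0 K).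
  by apply: cvgMl_tmp; exact: cvg_id.
Unshelve. all: by end_near. Qed.

(** * Differentiability in the noise power *)

Section derivable_ser.
Context {R : realType} {n : nat}.
Local Notation mR := (measurableTypeR R).

Lemma is_derive_gauss (x : n.-tuple R) (u : R) :
  is_derive u 1 (fun u => gauss n u x) (- dot x x * gauss n u x).
Proof.
pose g : R -> R := fun u => - (u * dot x x).
have dg : is_derive u 1 g (- dot x x).
  have -> : g = - (dot x x) \*: (id : R -> R).
    by apply/funext => w; rewrite /g /= mulrC -mulNr.
  by apply: is_derive_eq; rewrite scaler1.
have := is_derive1_comp (is_derive_expR (g u)) dg.
by rewrite mulrC.
Qed.

Lemma derivable_gauss_integral (A : set (n.-tuple mR)) (a : R) :
  measurable A -> 0 < a ->
  derivable (fun u => \int[lebesgue_tuple n]_(x in A) gauss n u x) a 1.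
Proof.
move=> mA a0.
have intg u : 0 < u -> (lebesgue_tuple n).-integrable A (EFin \o gauss n u).
  move=> u0; apply: (integrableS measurableT) => //; exact: integrable_gauss.
(* The window from [a / 2] to [2 * a] keeps [u] away from 0. Of the decay rate [a / 2], one half
   absorbs the factor [|x|^2] at the cost of [4 / a], and the other half keeps the dominating
   function integrable. *)
refine (@derivable_under_integral R _ _ (lebesgue_tuple n) (gauss n) A mA
  a (a / 2) (2 * a) _ _ _ (fun x => 4 / a * gauss n (a / 4) x) _ _ _).
- by rewrite /= in_itv/=; apply/andP; split; lra.
- move=> u; rewrite /= in_itv/= => /andP[au _]; apply: intg.
  by apply: lt_trans au; rewrite divr_gt0.
- by move=> u x _ _; case: (is_derive_gauss x u).
- by move=> x; rewrite mulr_ge0 ?expR_ge0// divr_ge0// ltW.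
- rewrite (_ : _ \o _ = fun x =>
    ((4 / a)%:E * (EFin \o gauss n (a / 4)) x)%E)//.
  by apply: integrableZl => //; apply: intg; rewrite divr_gt0.
- move=> u x; rewrite /= in_itv/= => /andP[au _] _.
  rewrite partial1of2E (@derive_val _ _ _ _ _ _ _ (is_derive_gauss x u)).
  have t0 : 0 <= dot x x := dot_ge0 _ x; set t := dot x x in t0 *.
  rewrite normrM normrN (ger0_norm t0) ger0_norm ?expR_ge0//.
  (* [t e^(-ut) <= t e^(-at/4) e^(-at/4)] and [y e^(-y) <= 1] at [y = at/4] *)
  have e1 : gauss n u x <= expR (- (a / 4 * t)) * gauss n (a / 4) x.
    by rewrite /gauss -expRD ler_expR -/t; nra.
  apply: (le_trans (ler_wpM2l t0 e1)).
  rewrite mulrA ler_wpM2r ?expR_ge0//.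
  have := expR_ge1Dx (a / 4 * t); rewrite expRN ler_pdivrMr ?expR_gt0//.
  have a4 : 0 <= 4 / a by rewrite divr_ge0// ltW.
  move=> /(ler_wpM2l a4).
  apply: le_trans; rewrite mulrDr mulr1.
  have -> : 4 / a * (a / 4 * t) = t by field; rewrite gt_eqF.
  by rewrite lerDr divr_ge0 // ltW.
Qed.

(** Near [P] the error at power [Q] is [1 - c Q * H (1 / (2 Q))], a power function times a Gaussian
    integral, so the product and chain rules apply. *)
Lemma derivable_symbol_error M (s : 'I_M -> n.-tuple R) (i : 'I_M) (P : R) :
  measurable (decision_region s i) ->
  0 < P -> derivable (symbol_error s i) P 1.
Proof.
move=> mD P0.
pose H u := \int[lebesgue_tuple n]_(x in decision_region s i) gauss n u x.
pose c (Q : R) := (2 * pi * Q) `^ (- (n%:R / 2)).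
have dlin (k : R) : derivable (fun Q : R => k * Q) P 1.
  have -> : (fun Q : R => k * Q) = k \*: (id : R -> R) by [].
  exact: derivableZ.
apply: (@near_eq_derivable _ _ _
    (cst 1 - (c * (H \o (fun Q => (2 * Q)^-1))))).
  near=> Q; have Q0 : 0 < Q by near: Q; exact: lt_nbhsr.
  rewrite /symbol_error; congr (1 - _).
  under [RHS]eq_Rintegral do rewrite noise_pdfE.
  rewrite RintegralZl//; apply: (integrableS measurableT) => //.
  by apply: integrable_gauss; rewrite invr_gt0 mulr_gt0.
have p0 : 0 < 2 * pi * P by rewrite !mulr_gt0 ?pi_gt0.
apply: derivableB; first exact: derivable_cst.
apply: derivableM.
  have -> : c =
    (fun Q : R => Q `^ (- (n%:R / 2))) \o (fun Q => 2 * pi * Q) by [].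
  apply/derivable1_diffP/differentiable_comp; first exact/derivable1_diffP.
  by apply/derivable1_diffP; apply: derivable_powR; rewrite in_itv/= andbT.
apply/derivable1_diffP/differentiable_comp; apply/derivable1_diffP.
  by apply: derivableV => //; rewrite gt_eqF// mulr_gt0.
apply: derivable_gauss_integral => //.
by rewrite invr_gt0 mulr_gt0.
Unshelve. all: by end_near. Qed.
End derivable_ser.

(** * The error rate on the closed half-line *)

Section ser.
Context {R : realType} {n M : nat} (s : 'I_M -> n.-tuple R) (prior : 'I_M -> R).
Hypotheses (s_inj : injective s) (prior_ge0 : forall i, 0 <= prior i).

Lemma ser_0 : ser s prior 0 = 0.
Proof. by rewrite /ser eqxx; apply/cvg_lim => //; exact: ser_pos_cvg0. Qed.

Lemma derivable_ser (P : R) : 0 < P -> derivable (ser s prior) P 1.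
Proof.
move=> P0; apply: (@near_eq_derivable _ _ _
    (\sum_(i < M) (symbol_error s i * cst (prior i)))).
  (* Close to a positive power the separate value at 0 is never met. *)
  near=> Q; have Q0 : 0 < Q by near: Q; exact: lt_nbhsr.
  by rewrite /ser gt_eqF// fct_sumE.
apply: derivable_sum => i; apply: derivableM; last exact: derivable_cst.
by apply: derivable_symbol_error => //; exact: measurable_decision_region.
Unshelve. all: by end_near. Qed.

Lemma continuous_ser (b : R) : 0 < b ->
  {within `[0, b], continuous (ser s prior)}.
Proof.
move=> b0.
have ser_cont (P : R) : 0 < P -> {for P, continuous (ser s prior)}.
  by move=> P0; apply/differentiable_continuous/derivable1_diffP/derivable_ser.
apply/continuous_within_itvP => //; split.
- by move=> P; rewrite in_itv/= => /andP[P0 _]; exact: ser_cont.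
(* Right continuity at 0: to the right of 0, [ser] is [ser_pos], which tends to 0. *)
- rewrite ser_0; apply: cvg_trans (ser_pos_cvg0 s prior s_inj prior_ge0).
  apply: near_eq_cvg; near=> Q.
  by rewrite /ser gt_eqF//; near: Q; exact: nbhs_right_gt.
- exact/cvg_at_left_filter/ser_cont.
Unshelve. all: by end_near. Qed.
End ser.

(** * Power/time sharing strategies *)

Lemma feasible_on_off {R : realType} (P0 PN : R) : 0 < P0 -> 0 <= PN ->
  feasible PN (on_off_sharing P0 PN).
Proof.
move=> P0_gt0 PN_ge0; rewrite /on_off_sharing; case: (leP P0 PN) => PN_P0.
  split; last 2 first.
  - by rewrite big_seq1.
  - by rewrite big_seq1 mul1r.
  by move=> p; rewrite inE => /eqP->.
split.
- move=> p; rewrite !inE => /orP[]/eqP->/=; split => //.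
  + exact/divr_ge0/ltW.
  + exact: ltW.
  + by rewrite subr_ge0 ler_pdivrMr// mul1r ltW.
- by rewrite !big_cons big_nil /= addr0 addrC subrK.
- by rewrite !big_cons big_nil /= mulr0 !addr0 divfK// gt_eqF.
Qed.

Theorem theorem12 (R : realType) (n M : nat)
    (s : 'I_M -> n.-tuple R) (prior : 'I_M -> R) (P0 PN : R)
    (s_constellation : constellation s)
    (prior_distr : prior_distribution prior)
    (inflection : single_inflection (ser s prior) P0)
    (PN_ge0 : 0 <= PN) :
  let Pe := ser s prior in
  let S := on_off_sharing P0 PN in
  [/\ feasible PN S,
      sharing_ser Pe S = on_off_ser Pe P0 PN,
      sharing_ser Pe (no_sharing PN) <= sharing_ser Pe S,
      (0 < PN -> PN < P0 ->
        sharing_ser Pe (no_sharing PN) < sharing_ser Pe S) &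
      ((sharing_ser Pe S)%:E <= optimal_ser Pe PN)%E].
Proof.
move=> Pe S.
have [_ s_inj _] := s_constellation.
have [prior_ge0 _] := prior_distr.
have [P0_gt0 _ Pe''_gt0 _] := inflection.
have Pe0 : Pe 0 = 0 by exact: ser_0.
have S_feasible : feasible PN S by exact: feasible_on_off.
have no_sharingE : sharing_ser Pe (no_sharing PN) = Pe PN.
  by rewrite /sharing_ser big_seq1 mul1r.
have SE : sharing_ser Pe S = on_off_ser Pe P0 PN.
  rewrite /S /sharing_ser /on_off_sharing /on_off_ser.
  case: ifP => _; first by rewrite big_seq1 mul1r.
  (* The off-interval contributes nothing because [Pe] vanishes at zero power. *)
  by rewrite !big_cons big_nil /= Pe0 mulr0 !addr0.
have lt_on_off : 0 < PN -> PN < P0 -> Pe PN < on_off_ser Pe P0 PN.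
  move=> PN_gt0 PN_P0; rewrite /on_off_ser (leNgt P0) PN_P0/=.
  (* The on-off rate is the height at [PN] of the chord over [[0, P0]]. *)
  apply: chord_lt => //; first exact: continuous_ser.
    by move=> y; rewrite in_itv/= => /andP[y0 _]; exact: derivable_ser.
  by move=> y; rewrite in_itv/= => /andP[y0 yP0]; exact: Pe''_gt0.
split => //.
- rewrite no_sharingE SE; have [P0_PN|PN_P0] := leP P0 PN.
    by rewrite /on_off_ser P0_PN.
  have [PN_gt0|PN_le0] := ltP 0 PN; first exact/ltW/lt_on_off.
  (* At zero average power both strategies have error rate 0. *)
  have -> : PN = 0 by apply/eqP; rewrite eq_le PN_le0.
  by rewrite /on_off_ser (leNgt P0) P0_gt0/= !mul0r Pe0.
- by rewrite no_sharingE SE.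
- by apply: ereal_sup_ubound; exists S.
Qed.
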